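(* Let $\Omega=\{1,\dots,d\}$ (with its power set sigma algebra), and identify probability measures on $\Omega$ with vectors in the simplex $\Delta_d=\{p\in[0,1]^d:\sum_{i=1}^dp_i=1\}$. Let $\mathcal P,\mathcal Q\subseteq\Delta_d$ be nonempty, convex and compact. Assume that $\sup_{\mathsf P\in\mathcal P}\mathsf P_i>0$ for all $i\in\{1,\dots,d\}$. Then $\mathcal E=\mathcal E_b$ and $$\mathsf G=\mathsf G_b=\max_{X\in\mathcal E_b}\inf_{\mathsf Q\in\mathcal Q}\mathbb E_{\mathsf Q}[\log X]=\min_{\mathsf Q\in\mathcal Q}\min_{\mathsf P\in\mathcal P}H(\mathsf Q\mid\mathsf P)<\infty,$$ meaning that the GROW value $\mathsf G$ is finite and is attained by some bounded e-variable $X^*\in\mathcal E_b$. Moreover, if $(\mathsf P^*,\mathsf Q^* )\in\mathcal P\times\mathcal Q$ minimizes the right-hand side, then $X^*=d\mathsf Q^*/d\mathsf P^*$, $\mathsf P^*$-a.s.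
   Context: An e-variable for $\mathcal P$ is a function $X:\Omega\to[0,\infty]$ with $\mathbb E_{\mathsf P}[X]\le1$ for all $\mathsf P\in\mathcal P$; $\mathcal E$ is the set of all e-variables and $\mathcal E_b$ the subset of those bounded from above, $\sup_\omega X(\omega)<\infty$. $\mathsf G=\sup_{X\in\mathcal E}\inf_{\mathsf Q\in\mathcal Q}\mathbb E_{\mathsf Q}[\log X]$ and $\mathsf G_b=\sup_{X\in\mathcal E_b}\inf_{\mathsf Q\in\mathcal Q}\mathbb E_{\mathsf Q}[\log X]$. Conventions: $\log0=-\infty$, $\log\infty=\infty$; $\mathbb E_{\mathsf Q}[\log X]=\mathbb E_{\mathsf Q}[(\log X)^+]-\mathbb E_{\mathsf Q}[(\log X)^-]$ if $\mathbb E_{\mathsf Q}[(\log X)^-]<\infty$, and $=-\infty$ otherwise. $H(\mathsf Q\mid\mathsf P)=\int\log(d\mathsf Q/d\mathsf P)\,d\mathsf Q$ if $\mathsf Q\ll\mathsf P$ and $=\infty$ otherwise. *)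

(* Defs.v *)
From HB Require Import structures.
From mathcomp Require Import all_boot all_order all_algebra.
From mathcomp Require Import all_classical all_reals all_analysis.

Set Implicit Arguments.
Unset Strict Implicit.
Unset Printing Implicit Defensive.

Import Order.TTheory GRing.Theory Num.Theory.
Import numFieldNormedType.Exports.

Local Open Scope classical_set_scope.
Local Open Scope ring_scope.
Local Open Scope charge_scope.

(* A measurableType is nonempty, so the sample space is indexed by n = d - 1:
   Omega n has d = n.+1 points. *)
Definition Omega (n : nat) : Type := 'I_n.+1.

HB.instance Definition _ n := Choice.on (Omega n).
HB.instance Definition _ n := isPointed.Build (Omega n) (@ord0 n).
HB.instance Definition _ n := @isMeasurable.Build default_measure_display
  (Omega n) discrete_measurable discrete_measurable0
  discrete_measurableC discrete_measurableU.

Section Defs.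
Context {R : realType} {n : nat}.
Implicit Types (PP QQ : set (probability (Omega n) R)).
Implicit Types (P Q : probability (Omega n) R) (X : Omega n -> \bar R).

Definition simplex : set 'rV[R]_n.+1 :=
  [set p | (forall i, 0 <= p ord0 i <= 1) /\ \sum_i p ord0 i = 1].

Definition vec P : 'rV[R]_n.+1 := \row_i fine (P [set (i : Omega n)]).

(* The probability measures whose vectors lie in A. *)
Definition measures (A : set 'rV[R]_n.+1) : set (probability (Omega n) R) :=
  vec @^-1` A.

Local Open Scope ereal_scope.

(* Every function on Omega n is measurable, since the sigma-algebra is the
   power set. *)
Definition evar PP : set (Omega n -> \bar R) :=
  [set X | (forall w, 0 <= X w) /\
           (forall P, PP P -> (\int[P]_w X w) <= 1)].

Definition evar_b PP : set (Omega n -> \bar R) :=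
  [set X | evar PP X /\ ereal_sup (range X) < +oo].

(* lne 0 = -oo and lne +oo = +oo. *)
Definition Elog Q X : \bar R :=
  let f := fun w => lne (X w) in
  if (\int[Q]_w f^\- w) < +oo
  then (\int[Q]_w f^\+ w) - (\int[Q]_w f^\- w)
  else -oo.

Definition growth QQ X : \bar R := ereal_inf [set Elog Q X | Q in QQ].

Definition G PP QQ : \bar R := ereal_sup [set growth QQ X | X in evar PP].

Definition G_b PP QQ : \bar R := ereal_sup [set growth QQ X | X in evar_b PP].

Definition RN Q P : Omega n -> \bar R :=
  'd (charge_of_finite_measure Q) '/d P.

Definition H Q P : \bar R :=
  if `[< Q `<< P >] then \int[Q]_w lne (RN Q P w) else +oo.

Definition is_max (A : set (\bar R)) (m : \bar R) := A m /\ ubound A m.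

Definition is_min (A : set (\bar R)) (m : \bar R) := A m /\ lbound A m.

End Defs.

(* Main.v *)
Require Import Defs.
From mathcomp Require Import all_boot all_order all_algebra.
From mathcomp Require Import all_classical all_reals all_analysis.
From mathcomp Require Import ring lra.

Set Implicit Arguments.
Unset Strict Implicit.
Unset Printing Implicit Defensive.

Import Order.TTheory GRing.Theory Num.Theory.
Import numFieldNormedType.Exports.

Local Open Scope classical_set_scope.
Local Open Scope ring_scope.

(** On a finite space everything can be written with vectors: the growth of an
e-variable [x] under [q] is [elog q x], the sum of the [q_i ln x_i], and the
relative entropy is [kl q p], the sum of the [q_i ln (q_i / p_i)].

Some [p0] in the null set [A] charges every point ([positive_point]), by
convexity.  Hence an e-variable is bounded by [1 / p0] coordinatewise, and the
e-variables form a compact set.  Both [elog q] and [kl] are optimal values of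
families of affine functions ([elog_geP] and [kl_leP]), so [elog q] is upper
and [kl] lower semicontinuous, infinite values included.  By compactness the
entropy has a minimizer on [A] x [B] ([kl_min]) and the worst-case growth has a
maximizer among the e-variables ([elog_max]).

Weak duality, [elog q x <= kl q p] for every e-variable [x], is Gibbs'
inequality ([gibbs_term], [elog_le_kl]).  It holds term by term, so equality of
the sums forces [q_i = p_i x_i] for all [i] ([elog_eq_kl]); this is the last
claim of the theorem, since the sums are equal at the optimum.

For strong duality one would like to take [x = q / p] at a minimizer [(p, q)]
of the entropy, but the optimality of [(p, q)] says nothing about points that
[p] does not charge.  Therefore [A] is first replaced by the measures
[(1 - e) p + e p0], which charge every point.  There the first-order conditions
at a minimizer [(r, q)] say that [q / r] is an e-variable
([kl_min_dual_feasible]) whose growth under every element of [B] is at least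
the minimal entropy ([kl_min_le_elog]).  Scaled by [1 - e], it is an e-variable
for [A] and loses only [- ln (1 - e)] of growth ([near_optimal_evar]).  So the
maximal growth is at least the minimal entropy up to an arbitrarily small error
([kl_elog_saddle]).

It remains to identify probabilities on the finite space with vectors
([vec_surjective]) and to evaluate [Elog] and [H] as finite sums ([Elog_vec],
[H_vec]). *)

(** * Segments of probability vectors *)

Section Vectors.
Context {R : realType} {n : nat}.
Implicit Types (p q r x y : 'rV[R]_n.+1) (a b c t : R).

Definition mix t p q : 'rV[R]_n.+1 := (1 - t) *: p + t *: q.

Lemma mixE t p q i : mix t p q ord0 i = (1 - t) * p ord0 i + t * q ord0 i.
Proof. by rewrite !mxE. Qed.

Lemma sum_mix t p q :
  \sum_i mix t p q ord0 i = (1 - t) * \sum_i p ord0 i + t * \sum_i q ord0 i.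
Proof.
by rewrite !mulr_sumr -big_split; apply: eq_bigr => i _; rewrite mixE.
Qed.

Lemma mix_ge0 t p q i : 0 <= t <= 1 -> 0 <= p ord0 i -> 0 <= q ord0 i ->
  0 <= mix t p q ord0 i.
Proof.
by move=> /andP[t0 t1] p0 q0; rewrite mixE addr_ge0 ?mulr_ge0 ?subr_ge0.
Qed.

Lemma mix_gt0r t p q i : 0 < t <= 1 -> 0 <= p ord0 i -> 0 < q ord0 i ->
  0 < mix t p q ord0 i.
Proof.
move=> /andP[t0 t1] p0 q0.
by rewrite mixE ltr_wpDl ?mulr_ge0 ?subr_ge0// mulr_gt0.
Qed.

Lemma mix_gt0l t p q i : 0 <= t < 1 -> 0 < p ord0 i -> 0 <= q ord0 i ->
  0 < mix t p q ord0 i.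
Proof.
move=> /andP[t0 t1] p0 q0.
by rewrite mixE ltr_wpDr ?mulr_ge0// mulr_gt0// subr_gt0.
Qed.

Lemma simplex_ge0 p i : simplex p -> 0 <= p ord0 i.
Proof. by case=> /(_ i) /andP[]. Qed.

Lemma simplex_intro p : (forall i, 0 <= p ord0 i) -> \sum_i p ord0 i = 1 ->
  simplex p.
Proof.
move=> p0 p1; split => // i; rewrite p0/= -p1 (bigD1 i)//= lerDl.
exact: sumr_ge0.
Qed.

Lemma simplex_mix t p q : 0 <= t <= 1 -> simplex p -> simplex q ->
  simplex (mix t p q).
Proof.
move=> t01 sp sq; apply: simplex_intro => [i|].
  by rewrite mix_ge0 ?simplex_ge0.
by rewrite sum_mix sp.2 sq.2; ring.
Qed.

Lemma convex_set_mix (A : set 'rV[R]_n.+1) t p q :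
  convex_set (A : set (convex_lmodType 'rV[R]_n.+1)) ->
  0 <= t <= 1 -> A p -> A q -> A (mix t p q).
Proof.
move=> cA /andP[t0 t1] Ap Aq.
have := cA (q : convex_lmodType 'rV[R]_n.+1) p (Itv01 t0 t1).
rewrite !inE => /(_ Aq Ap); congr (A _).
by rewrite /mix addrC.
Qed.

(** Replaces differentiation at the minimizer: the optimality conditions below
are bounds, at every [t] of a segment, by a function affine in [t], and only
the value at [t = 0] is wanted. *)
Lemma le_of_affine a b c : (forall t, 0 < t < 1 -> a <= b + t * c) -> a <= b.
Proof.
move=> h; rewrite leNgt; apply/negP => ba.
(* small enough for e < 1 and for e * |c| < a - b *)
pose e := (a - b) / (2 * (1 + `|c| + (a - b))).
have d0 : 0 < 2 * (1 + `|c| + (a - b)).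
  by rewrite mulr_gt0// addr_gt0 ?subr_gt0// ltr_pwDl.
have e01 : 0 < e < 1.
  rewrite divr_gt0 ?subr_gt0//= ltr_pdivrMr// mul1r.
  have := normr_ge0 c; lra.
have := h _ e01; apply/negP; rewrite -ltNge -ltrBrDl.
apply: (@le_lt_trans _ _ (e * `|c|)).
  by rewrite ler_wpM2l ?ler_norm//; case/andP: e01 => /ltW.
rewrite /e mulrAC ltr_pdivrMr// ltr_pM2l ?subr_gt0//.
have := normr_ge0 c; lra.
Qed.

(** * Expected logarithms, relative entropy and weak duality *)

Lemma ln_leif_sub1 a : 0 < a -> ln a <= a - 1 ?= iff (a == 1).
Proof.
move=> a0; apply/leifP; case: eqVneq => [->|a1]; first by rewrite ln1 subrr.
have la0 : ln a != 0 by rewrite ln_eq0.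
by rewrite ltrBrDl -[ltRHS]lnK ?posrE// expR_gt1Dx.
Qed.

(** One term of Gibbs' inequality: [ln z <= z - 1] at [z = p x / q].  Over a
probability [q] and an e-variable [x] the corrections [p x - q] add up to at
most [0].  The equality case is recorded because it yields uniqueness. *)
Lemma gibbs_term (q p x : R) : 0 <= q -> 0 <= p -> 0 <= x ->
  (p = 0 -> q = 0) -> (0 < q -> 0 < x) ->
  q * ln x <= q * ln (q / p) + (p * x - q) ?= iff (q == p * x).
Proof.
move=> q0 p0 x0 pq qx.
have [->|qN0] := eqVneq q 0.
  rewrite !mul0r add0r subr0; apply/leifP; rewrite eq_sym.
  by case: eqVneq => // px; rewrite lt_neqAle eq_sym px mulr_ge0.
have {}q0 : 0 < q by rewrite lt_neqAle eq_sym qN0.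
have {}x0 : 0 < x by exact: qx.
have {}p0 : 0 < p.
  by rewrite lt_neqAle p0 andbT eq_sym; apply: contra_neq qN0 => /pq.
have z0 : 0 < p * x / q by rewrite divr_gt0 ?mulr_gt0.
have lnx : ln x = ln (q / p) + ln (p * x / q).
  rewrite -lnM ?posrE ?divr_gt0 ?mulr_gt0 //.
  by congr (ln _); field; rewrite !gt_eqF.
have pxq : p * x - q = q * (p * x / q - 1) by field.
have eqz : (q == p * x) = (p * x / q == 1).
  by rewrite eq_sym -[RHS](inj_eq (mulIf qN0)) divfK// mul1r.
have [le1 eq1] := ln_leif_sub1 z0.
rewrite lnx pxq eqz mulrDr.
by split; rewrite ?lerD2l ?(inj_eq (addrI _)) ?ler_pM2l// (inj_eq (mulfI qN0)).
Qed.

Local Open Scope ereal_scope.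

(** As [0 * -oo = 0] in the extended reals, points that [q] does not charge
contribute nothing, and the value is [-oo] as soon as [x] vanishes at a point
that [q] charges. *)
Definition elog q x : \bar R := \sum_i (q ord0 i)%:E * lne (x ord0 i)%:E.

(** Where [q] and [p] both vanish, the term is [0 * ln 0 = 0]. *)
Definition kl q p : \bar R :=
  if `[< forall i, p ord0 i = 0%R -> q ord0 i = 0%R >]
  then (\sum_i q ord0 i * ln (q ord0 i / p ord0 i))%:E else +oo.

Lemma elog_fin q x : (forall i, 0 <= q ord0 i)%R ->
  (forall i, 0 < q ord0 i -> 0 < x ord0 i)%R ->
  elog q x = (\sum_i q ord0 i * ln (x ord0 i))%:E.
Proof.
move=> q0 qx; rewrite /elog -sumEFin; apply: eq_bigr => i _.
have := q0 i; rewrite le_eqVlt => /predU1P[<-|qi]; first by rewrite mul0e mul0r.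
by rewrite lne_EFin ?qx// EFinM.
Qed.

Lemma elog_Ny q x i : (0 < q ord0 i)%R -> (x ord0 i <= 0)%R -> elog q x = -oo.
Proof.
move=> qi xi; apply/esum_eqNyP; exists i; split => //.
by rewrite le0_lneNy ?lee_fin// mulrNy gtr0_sg// mul1e.
Qed.

Lemma elogP q x : (forall i, 0 <= q ord0 i)%R ->
  elog q x = -oo \/ (forall i, 0 < q ord0 i -> 0 < x ord0 i)%R.
Proof.
move=> q0.
have [|/forallNP h] := pselect (exists i, 0 < q ord0 i /\ x ord0 i <= 0)%R.
  by case=> i [qi xi]; left; exact: elog_Ny xi.
right => i qi; rewrite ltNge; apply/negP => xi; exact: (h i).
Qed.

Lemma kl_fin q p : (forall i, p ord0 i = 0%R -> q ord0 i = 0%R) ->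
  kl q p = (\sum_i q ord0 i * ln (q ord0 i / p ord0 i))%:E.
Proof. by rewrite /kl => h; case: asboolP. Qed.

(** Weak duality: summing [gibbs_term], the corrections amount to the integral
of [x] under [p] minus [1]. *)
Lemma elog_le_kl q p x : simplex q -> (forall i, 0 <= p ord0 i)%R ->
  (forall i, 0 <= x ord0 i)%R -> (\sum_i p ord0 i * x ord0 i <= 1)%R ->
  elog q x <= kl q p.
Proof.
move=> sq p0 x0 px; rewrite /kl; case: asboolP => [pq|_]; last exact: leey.
have q0 i := simplex_ge0 i sq.
have [->|qx] := elogP x q0; first exact: leNye.
rewrite elog_fin// lee_fin.
have H i : true -> _ := fun=> gibbs_term (q0 i) (p0 i) (x0 i) (pq i) (qx i).
apply: le_trans (leif_sum H).1 _.
by rewrite big_split/= sumrB sq.2 gerDl subr_le0.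
Qed.

(** Equality of the sums forces equality in every term of Gibbs' inequality. *)
Lemma elog_eq_kl q p x : simplex q -> (forall i, 0 <= p ord0 i)%R ->
  (forall i, 0 <= x ord0 i)%R -> (\sum_i p ord0 i * x ord0 i <= 1)%R ->
  kl q p \is a fin_num -> elog q x = kl q p ->
  forall i, q ord0 i = (p ord0 i * x ord0 i)%R.
Proof.
move=> sq p0 x0 px; rewrite /kl; case: asboolP => [pq|_]// _.
have q0 i := simplex_ge0 i sq.
have [->|qx]// := elogP x q0.
rewrite elog_fin// => -[E].
have H i : true -> _ := fun=> gibbs_term (q0 i) (p0 i) (x0 i) (pq i) (qx i).
have [le1 eq1] := leif_sum H.
have : [forall (i | true), q ord0 i == (p ord0 i * x ord0 i)%R].
  rewrite -eq1 eq_le le1/= E big_split/= sumrB sq.2.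
  by rewrite gerDl subr_le0.
by move=> /forall_inP h i; apply/eqP; exact: h.
Qed.

(** * Semicontinuity through tangent lines *)

(** The logarithm is the infimum of its tangents [ln y + x / y - 1], [y > 0],
also at [x = 0], where the infimum is [-oo].  The point is that the right-hand
side is affine in [x] and in [q]. *)
Lemma elog_geP q x a : (forall i, 0 <= q ord0 i)%R ->
  (forall i, 0 <= x ord0 i)%R ->
  a%:E <= elog q x <->
  (forall y, (forall i, 0 < y ord0 i) ->
    a <= \sum_i q ord0 i * (ln (y ord0 i) + x ord0 i / y ord0 i - 1))%R.
Proof.
move=> q0 x0; split.
  have [->|qx] := elogP x q0; first by rewrite leeNy_eq.
  rewrite elog_fin// lee_fin => ax y y0.
  apply: le_trans ax _; apply: ler_sum => i _.
  have := q0 i; rewrite le_eqVlt => /predU1P[<-|qi]; first by rewrite !mul0r.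
  have xi := qx i qi; rewrite ler_pM2l// -addrA -lerBlDl -ln_div ?posrE//.
  exact: (ln_leif_sub1 (divr_gt0 xi (y0 i))).1.
move=> h.
have [[i [qi xi]]|/forallNP qx] :=
    pselect (exists i, 0 < q ord0 i /\ x ord0 i <= 0)%R.
  (* the tangent at a small y_i brings the bound down to a - q_i *)
  pose C := (\sum_(j | j != i) q ord0 j * (ln 1 + x ord0 j / 1 - 1))%R.
  pose y : 'rV[R]_n.+1 :=
    \row_j (if j == i then expR ((a - C) / q ord0 i) else 1%R).
  have y0 j : (0 < y ord0 j)%R.
    by rewrite mxE; case: ifP => // _; exact: expR_gt0.
  have := h y y0; rewrite (bigD1 i)//= mxE eqxx.
  have -> : (\sum_(j < n.+1 | j != i)
      q ord0 j * (ln (y ord0 j) + x ord0 j / y ord0 j - 1))%R = C.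
    by apply: eq_bigr => j ji; rewrite mxE (negbTE ji).
  have -> : x ord0 i = 0%R by apply/le_anti; rewrite xi x0.
  rewrite mul0r addr0 expRK mulrBr mulrC divfK ?gt_eqF// mulr1.
  by rewrite (_ : _ + C = a - q ord0 i)%R ?lerBrDr ?gerDl ?leNgt ?qi//; ring.
have {}qx i : (0 < q ord0 i -> 0 < x ord0 i)%R.
  by move=> qi; rewrite ltNge; apply/negP => xi; exact: (qx i).
rewrite elog_fin// lee_fin.
pose y : 'rV[R]_n.+1 := \row_j (if (0 < x ord0 j)%R then x ord0 j else 1%R).
have y0 j : (0 < y ord0 j)%R by rewrite mxE; case: ifP.
apply: le_trans (h y y0) _; apply: ler_sum => i _.
have := q0 i; rewrite le_eqVlt => /predU1P[<-|qi]; first by rewrite !mul0r.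
by rewrite mxE qx// divff ?gt_eqF ?qx// addrK.
Qed.

(** The Donsker-Varadhan formula: by [gibbs_term] the entropy is the supremum
over [x > 0] of functions affine in [(q, p)], approached at [x = q / p].  This
makes it jointly lower semicontinuous, although [q ln (q / p)] is discontinuous
at the origin. *)
Lemma kl_leP q p a : simplex q -> simplex p ->
  kl q p <= a%:E <->
  (forall x, (forall i, 0 < x ord0 i) ->
    \sum_i (q ord0 i * ln (x ord0 i) + q ord0 i - p ord0 i * x ord0 i) <= a)%R.
Proof.
move=> sq sp; have q0 i := simplex_ge0 i sq; have p0 i := simplex_ge0 i sp.
split.
  rewrite /kl; case: asboolP => [pq|_]; last by rewrite leye_eq.
  rewrite lee_fin => kla x x0; apply: le_trans kla.
  apply: ler_sum => i _; rewrite -addrA -lerBrDr opprB.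
  exact: (gibbs_term (q0 i) (p0 i) (ltW (x0 i)) (pq i) (fun=> x0 i)).1.
move=> h; rewrite /kl; case: asboolP => [pq|]; last first.
  move=> /existsNP[i] /not_implyP[pi /eqP qi].
  have {}qi : (0 < q ord0 i)%R by rewrite lt_neqAle eq_sym qi q0.
  (* where p vanishes but q does not, a large x_i gives the value a + q_i *)
  pose C := (\sum_(j | j != i) (q ord0 j * ln 1 + q ord0 j - p ord0 j * 1))%R.
  pose x : 'rV[R]_n.+1 :=
    \row_j (if j == i then expR ((a - C) / q ord0 i) else 1%R).
  have x0 j : (0 < x ord0 j)%R.
    by rewrite mxE; case: ifP => // _; exact: expR_gt0.
  have := h x x0; rewrite (bigD1 i)//= mxE eqxx.
  have -> : (\sum_(j < n.+1 | j != i)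
      (q ord0 j * ln (x ord0 j) + q ord0 j - p ord0 j * x ord0 j))%R = C.
    by apply: eq_bigr => j ji; rewrite mxE (negbTE ji).
  rewrite pi mul0r subr0 expRK mulrC divfK ?gt_eqF//.
  by rewrite (_ : _ + C = a + q ord0 i)%R ?gerDl ?leNgt ?qi//; ring.
rewrite lee_fin; apply/ler_addgt0Pr => e e0.
(* x_j has to be positive; taking e where q vanishes costs at most e in all *)
pose x : 'rV[R]_n.+1 :=
  \row_j (if (0 < q ord0 j)%R then (q ord0 j / p ord0 j)%R else e).
have x0 j : (0 < x ord0 j)%R.
  rewrite mxE; case: ifP => // qj; rewrite divr_gt0// lt_neqAle p0 andbT eq_sym.
  by apply/eqP => /pq qj0; rewrite qj0 ltxx in qj.
rewrite -lerBlDr; apply: le_trans (h x x0).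
rewrite -[X in (_ - X)%R]mulr1 -sp.2 mulr_sumr -sumrB.
apply: ler_sum => i _; rewrite mxE.
have := q0 i; rewrite le_eqVlt => /predU1P[<-|qi].
  by rewrite ltxx !mul0r !sub0r addr0 add0r mulrC.
have pi : (0 < p ord0 i)%R.
  by have := x0 i; rewrite mxE qi pmulr_rgt0// invr_gt0.
rewrite qi -addrA lerD2l (mulrC (p ord0 i)) divfK ?gt_eqF// subrr oppr_le0.
by rewrite mulr_ge0// ltW.
Qed.
End Vectors.

(** * Existence of optimizers *)

Lemma lte_real_between (R : realFieldType) (x y : \bar R) : (x < y)%E ->
  exists2 a : R, (x < a%:E)%E & (a%:E < y)%E.
Proof.
case: x y => [x| |] [y| |]//=; rewrite ?lte_fin => xy.
- by exists ((x + y) / 2); rewrite lte_fin ?midf_lt.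
- by exists (x + 1); rewrite ?ltry// lte_fin ltrDl.
- by exists (y - 1); rewrite ?ltNyr// lte_fin gtrDl oppr_lt0.
- by exists 0; rewrite ?ltNyr ?ltry.
Qed.

(** The extreme value theorem for lower semicontinuous functions with values in
the extended reals.  The sublevel sets above the infimum generate a filter on
[K]; as they are closed, each of them contains the cluster points of this
filter. *)
Lemma compact_min_attained (R : realType) (T : topologicalType) (K : set T)
    (f : T -> \bar R) : compact K -> K !=set0 ->
  (forall a : R, closed (K `&` [set x | (f x <= a%:E)%E])) ->
  exists2 x, K x & forall y, K y -> (f x <= f y)%E.
Proof.
move=> cK [x0 Kx0] clf.
set m := ereal_inf [set f x | x in K].
have [my|m_lty] := eqVneq m +oo%E.
  exists x0 => // y Ky; suff -> : f y = +oo%E by exact: leey.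
  by apply/eqP; rewrite -leye_eq -my; apply: ereal_inf_lbound; exists y.
pose D := [set a : R | (m < a%:E)%E].
pose B a := K `&` [set x | (f x <= a%:E)%E].
have [a0 Da0] : D !=set0.
  rewrite /D; move: m_lty; case: (m) => [r| |]// _.
    by exists (r + 1); rewrite /= lte_fin ltrDl.
  by exists 0; rewrite /= ltNyr.
have FB : ProperFilter (filter_from D B).
  apply: filter_from_proper; last first.
    move=> a Da; have [_ [x Kx <-] xa] := ereal_inf_lt Da.
    by exists x; split => //=; exact: ltW.
  apply: filter_from_filter; first by exists a0.
  move=> a b Da Db; exists (Num.min a b).
    by rewrite /D/=; case: (leP a b).
  by move=> x [Kx /= fx]; split; split=> //=; apply: le_trans fx _;
    rewrite lee_fin ge_min lexx ?orbT.
have [|x [Kx clx]] := cK (filter_from D B) FB.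
  by exists a0 => // x [].
exists x => // y Ky; apply: (@le_trans _ _ m); last first.
  by apply: ereal_inf_lbound; exists y.
have fx a : (m < a%:E)%E -> (f x <= a%:E)%E.
  move=> ma; suff /clf[] : closure (B a) x by [].
  by move=> U nU; apply: clx nU; exists a.
rewrite leNgt; apply/negP => mfx.
have [a ma afx] := lte_real_between mfx.
by have := fx _ ma; rewrite leNgt afx.
Qed.

Lemma closed_le_continuous (R : realType) (T : topologicalType) (I : Type)
    (D : set I) (f : I -> T -> R) (a : R) :
  (forall i, D i -> continuous (f i)) ->
  closed [set x | forall i, D i -> f i x <= a].
Proof.
move=> cf.
rewrite (_ : [set x | _] =
    \bigcap_(i in D) (f i @^-1` [set r | r <= a])); last first.
  by apply/seteqP; split => x /= h i Di; exact: h.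
apply: closed_bigI => i Di.
by apply: preimage_closed; [move=> x _; exact: cf|exact: closed_le].
Qed.

Lemma continuous_sumr (R : realType) (T : topologicalType) (I : finType)
    (f : I -> T -> R) : (forall i, continuous (f i)) ->
  continuous (fun x => \sum_i f i x).
Proof.
move=> cf; apply: continuous_big => // -[x y].
exact: (@add_continuous R).
Qed.

Section Duality.
Context {R : realType} {n : nat}.
Implicit Types (p q r x y : 'rV[R]_n.+1) (A B : set 'rV[R]_n.+1).
Implicit Types (a b c e t : R).

Let coordc i : continuous (fun x : 'rV[R]_n.+1 => x ord0 i).
Proof. exact: coord_continuous. Qed.

(** The mixture with [p0] is built into the objective: it maps [A] to measures
that charge every point that [p0] charges, and [e = 0] is the original problem.
*)
Lemma kl_mix_min A B e p0 : A `<=` simplex -> B `<=` simplex ->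
  A !=set0 -> B !=set0 -> compact A -> compact B -> simplex p0 -> 0 <= e <= 1 ->
  exists p q, [/\ A p, B q &
    forall p' q', A p' -> B q' -> (kl q (mix e p p0) <= kl q' (mix e p' p0))%E].
Proof.
move=> sA sB [pA ApA] [qB BqB] cA cB sp0 e01.
pose V := ('rV[R]_n.+1 * 'rV[R]_n.+1)%type.
pose f (z : V) := kl z.2 (mix e z.1 p0).
have AB0 : (A `*` B) !=set0 by exists (pA, qB).
have cAB := compact_setX cA cB.
have [a|[p q] [/= Ap Bq] h] := @compact_min_attained R _ _ f cAB AB0.
  pose D := [set x : 'rV[R]_n.+1 | forall i, 0 < x ord0 i].
  pose g x (z : V) : R := \sum_i (z.2 ord0 i * ln (x ord0 i) + z.2 ord0 i
    - ((1 - e) * z.1 ord0 i + e * p0 ord0 i) * x ord0 i).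
  have gE x p q : g x (p, q) = \sum_i (q ord0 i * ln (x ord0 i) + q ord0 i
      - mix e p p0 ord0 i * x ord0 i).
    by apply: eq_bigr => i _; rewrite mixE.
  rewrite (_ : _ `&` _ =
      (A `*` B) `&` [set z | forall x, D x -> g x z <= a]); last first.
    apply/seteqP; split => -[p q] [[/= Ap Bq] h]; split => //=.
      move=> x Dx; rewrite gE.
      exact: (iffLR (kl_leP a (sB _ Bq) (simplex_mix e01 (sA _ Ap) sp0)) h).
    apply/(kl_leP a (sB _ Bq) (simplex_mix e01 (sA _ Ap) sp0)) => x Dx.
    by rewrite -gE; exact: h.
  apply: closedI; first exact: compact_closed.
  apply: closed_le_continuous => x Dx; apply: continuous_sumr => i z.
  have c1 : {for z, continuous (fun z : V => z.1 ord0 i)}.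
    apply: (@continuous_comp _ _ _ fst (fun x => x ord0 i)).
      exact: cvg_fst.
    exact: coordc.
  have c2 : {for z, continuous (fun z : V => z.2 ord0 i)}.
    apply: (@continuous_comp _ _ _ snd (fun x => x ord0 i)).
      exact: cvg_snd.
    exact: coordc.
  apply: cvgB; first by apply: cvgD => //; apply: cvgM => //; exact: cvg_cst.
  apply: cvgM; last exact: cvg_cst.
  by apply: cvgD; [apply: cvgM => //; exact: cvg_cst|exact: cvg_cst].
by exists p, q; split => // p' q' Ap' Bq'; apply: (h (p', q')).
Qed.

Lemma kl_min A B : A `<=` simplex -> B `<=` simplex ->
  A !=set0 -> B !=set0 -> compact A -> compact B ->
  exists p q, [/\ A p, B q &
    forall p' q', A p' -> B q' -> (kl q p <= kl q' p')%E].
Proof.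
move=> sA sB [pA ApA] B0 cA cB.
have mix0 p : mix 0 p pA = p by rewrite /mix subr0 scale1r scale0r addr0.
have [||p [q [Ap Bq h]]] := @kl_mix_min A B 0 pA sA sB _ B0 cA cB (sA _ ApA).
- by exists pA.
- by rewrite lexx ler01.
exists p, q; split => // p' q' Ap' Bq'.
by have := h p' q' Ap' Bq'; rewrite !mix0.
Qed.

(** The constraint from a single [p0] without zeros already bounds the feasible
set, and an infimum of upper semicontinuous functions is upper semicontinuous.
*)
Lemma elog_max A B p0 : B `<=` simplex -> A p0 ->
  (forall i, 0 < p0 ord0 i) ->
  exists x, [/\ forall i, 0 <= x ord0 i,
    forall p, A p -> \sum_i p ord0 i * x ord0 i <= 1 &
    forall y, (forall i, 0 <= y ord0 i) ->
      (forall p, A p -> \sum_i p ord0 i * y ord0 i <= 1) ->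
      (ereal_inf [set elog q y | q in B] <=
       ereal_inf [set elog q x | q in B])%E].
Proof.
move=> sB Ap0 p0_gt0.
pose K := [set x : 'rV[R]_n.+1 | (forall i, 0 <= x ord0 i) /\
    forall p, A p -> \sum_i p ord0 i * x ord0 i <= 1].
have clK : closed K.
  have -> : K = [set x : 'rV[R]_n.+1 | forall i, setT i -> - x ord0 i <= 0] `&`
      [set x | forall p, A p -> \sum_i p ord0 i * x ord0 i <= 1].
    apply/seteqP; split => x [x0 xA]; split=> // i.
      by rewrite oppr_le0.
    by have := x0 i I; rewrite oppr_le0.
  apply: closedI.
    by apply: closed_le_continuous => i _ x; apply: continuousN; exact: coordc.
  apply: closed_le_continuous => p Ap; apply: continuous_sumr => i x.
  by apply: continuousM; [exact: cst_continuous|exact: coordc].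
have cK : compact K.
  pose S i := `[0, (p0 ord0 i)^-1]%classic : set R.
  have /subclosed_compact :
      compact [set x : 'rV[R]_n.+1 | forall i, S i (x ord0 i)].
    by apply: (@rV_compact R n.+1 S) => i; exact: segment_compact.
  apply => // x [x0 xA] i; rewrite /S/= in_itv/= x0/=.
  rewrite -[leRHS]mul1r ler_pdivlMr// mulrC.
  apply: le_trans (xA _ Ap0); rewrite (bigD1 i)//= lerDl.
  by apply: sumr_ge0 => j _; rewrite mulr_ge0// ltW.
have K0 : K !=set0.
  exists 0; split => [i|p Ap]; first by rewrite mxE.
  by rewrite big1// => i _; rewrite mxE mulr0.
pose g x := ereal_inf [set elog q x | q in B].
have [a|x [x0 xA] h] := @compact_min_attained R _ K (fun x => - g x)%E cK K0.
  pose V := ('rV[R]_n.+1 * 'rV[R]_n.+1)%type.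
  pose D := [set qy : V | B qy.1 /\ forall i, 0 < qy.2 ord0 i].
  pose l (qy : V) (x : 'rV[R]_n.+1) := - \sum_i qy.1 ord0 i *
    (ln (qy.2 ord0 i) + x ord0 i / qy.2 ord0 i - 1).
  rewrite (_ : _ `&` _ =
      K `&` [set x | forall qy, D qy -> l qy x <= a]); last first.
    apply/seteqP; split => x [[x0 xA] /= h]; split => //=.
      move=> [q y] [/= Bq y0]; rewrite /l/= lerNl.
      have : ((- a)%:E <= elog q x)%E.
        apply: (@le_trans _ _ (g x)); first by rewrite EFinN leeNl.
        by apply: ereal_inf_lbound; exists q.
      by move/(elog_geP _ (fun i => simplex_ge0 i (sB _ Bq)) x0); exact.
    rewrite leeNl -EFinN; apply: le_ereal_inf_tmp => _ [q Bq <-].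
    apply/(elog_geP _ (fun i => simplex_ge0 i (sB _ Bq)) x0) => y y0.
    by have := h (q, y) (conj Bq y0); rewrite /l/= lerNl.
  apply: closedI => //; apply: closed_le_continuous => -[q y] [/= Bq y0] x.
  apply: continuousN; move: x; apply: continuous_sumr => i x /=.
  apply: (@continuousM _ _ (cst (q ord0 i))
    (fun x => ln (y ord0 i) + x ord0 i / y ord0 i - 1)).
    exact: cst_continuous.
  apply: continuousB; last exact: cst_continuous.
  apply: continuousD; first exact: cst_continuous.
  by apply: continuousM; [exact: coordc|exact: cst_continuous].
exists x; split => // y y0 yA.
by have := h y (conj y0 yA); rewrite leeN2.
Qed.

(** * First-order conditions and strong duality *)

(** Moving [r] towards [p] does not decrease the entropy.  Its derivative at
[t = 0] is [1] minus the integral of [q / r] under [p]. *)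
Lemma kl_min_dual_feasible q r p : simplex q -> (forall i, 0 < r ord0 i) ->
  simplex r -> simplex p ->
  (forall t, 0 < t < 1 -> (kl q r <= kl q (mix t r p))%E) ->
  \sum_i p ord0 i * (q ord0 i / r ord0 i) <= 1.
Proof.
move=> sq r0 sr sp h.
have q0 i := simplex_ge0 i sq; have p0 i := simplex_ge0 i sp.
pose T i := q ord0 i * p ord0 i / r ord0 i.
pose b := \sum_i T i * ((p ord0 i - r ord0 i) / r ord0 i).
apply: (@le_of_affine _ _ _ b) => t t01.
have /andP[t0 t1] := t01.
pose w i := mix t r p ord0 i.
have w0 i : 0 < w i by rewrite mix_gt0l// (ltW t0).
(* the entropy does not decrease from r to w, and ln (r / w) <= r / w - 1 *)
have S1 : \sum_i q ord0 i * (1 - r ord0 i / w i) <= 0.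
  have := h t t01; rewrite !kl_fin; last 2 first.
  - by move=> i /eqP; rewrite gt_eqF.
  - by move=> i /eqP; rewrite gt_eqF.
  rewrite lee_fin -subr_ge0 -sumrB => h1.
  rewrite -oppr_ge0 -sumrN; apply: le_trans h1 _; apply: ler_sum => i _.
  have := q0 i; rewrite le_eqVlt => /predU1P[<-|qi].
    by rewrite ?(mul0r, subr0, oppr0).
  rewrite -mulrBr -mulrN ler_pM2l// opprB.
  rewrite (_ : _ - _ = ln (r ord0 i / w i)); last first.
    by rewrite !ln_div ?posrE//; ring.
  exact: (ln_leif_sub1 (divr_gt0 (r0 i) (w0 i))).1.

pose P := \sum_i q ord0 i * p ord0 i / w i.
pose S := \sum_i q ord0 i * r ord0 i / w i.
have S1' : 1 <= S.
  rewrite -subr_le0 -sq.2 -sumrB; apply: le_trans S1; rewrite le_eqVlt.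
  apply/orP; left; apply/eqP.
  by apply: eq_bigr => i _; rewrite mulrBr mulr1 mulrA.
have SP : (1 - t) * S + t * P = 1.
  rewrite -[RHS]sq.2 !mulr_sumr -big_split/=; apply: eq_bigr => i _.
  have wi := w0 i.
  transitivity (q ord0 i * (((1 - t) * r ord0 i + t * p ord0 i) / w i)).
    by ring.
  by rewrite -mixE divff ?gt_eqF// mulr1.
have P1 : P <= 1.
  have tS : (1 - t) * (1 - S) <= 0 by rewrite pmulr_rle0 ?subr_gt0 ?subr_le0.
  by rewrite -subr_ge0 -(pmulr_rge0 _ t0); lra.
rewrite -lerBlDr; apply: le_trans P1.
rewrite mulr_sumr -sumrB; apply: ler_sum => i _.
(* 1 / w lies above its tangent at r, which is affine in t *)
have ri := r0 i; have wi := w0 i.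
rewrite -subr_ge0.
have -> : q ord0 i * p ord0 i / w i -
  (p ord0 i * (q ord0 i / r ord0 i) -
    t * (T i * ((p ord0 i - r ord0 i) / r ord0 i))) =
  q ord0 i * p ord0 i * ((w i - r ord0 i) / r ord0 i) ^+ 2 / w i.
  have -> : w i = (1 - t) * r ord0 i + t * p ord0 i by rewrite /w mixE.
  rewrite /T; field; rewrite !gt_eqF//=.
  by rewrite -mixE; exact: wi.
by rewrite divr_ge0 ?(ltW wi)// mulr_ge0 ?sqr_ge0// mulr_ge0.
Qed.

(** Let [m = (1 - t) q + t q'].  The entropy of [m] is affine in the outer
weights: it is [(1 - t)] times the integral of [ln (m / r)] under [q], at most
[kl q r] by Gibbs' inequality, plus [t] times the one under [q'].  By minimality
the latter is at least [kl q r]; then [t] tends to [0]. *)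
Lemma kl_min_le_elog q r q' : simplex q -> (forall i, 0 < r ord0 i) ->
  simplex r -> simplex q' ->
  (forall t, 0 < t < 1 -> (kl q r <= kl (mix t q q') r)%E) ->
  (kl q r <= elog q' (\row_i (q ord0 i / r ord0 i))%R)%E.
Proof.
move=> sq r0 sr sq' h.
have q0 i := simplex_ge0 i sq; have q'0 i := simplex_ge0 i sq'.
have klE p : kl p r = (\sum_i p ord0 i * ln (p ord0 i / r ord0 i))%:E.
  by rewrite kl_fin// => i /eqP; rewrite gt_eqF.
set x := \row_i _.
have x0 i : 0 <= x ord0 i by rewrite mxE divr_ge0// ltW.
rewrite klE; set v := \sum_i _.
apply/(elog_geP v q'0 x0) => y y0.
pose b := \sum_i q' ord0 i * ((q' ord0 i - q ord0 i) / r ord0 i / y ord0 i).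
apply: (@le_of_affine _ _ _ b) => t t01.
have /andP[t0 t1] := t01.
have t01' : 0 <= t <= 1 by rewrite !ltW.
pose m := mix t q q'.
have m0 i : 0 <= m ord0 i by exact: mix_ge0.
have sm : simplex m by exact: simplex_mix.
have := h t t01; rewrite -/m !klE lee_fin -/v => vm.
have gibbs : \sum_i q ord0 i * ln (m ord0 i / r ord0 i) <= v.
  have H i : q ord0 i * ln (m ord0 i / r ord0 i) <=
      q ord0 i * ln (q ord0 i / r ord0 i) + (m ord0 i - q ord0 i).
    have [|||||le1 _] :=
      @gibbs_term R (q ord0 i) (r ord0 i) (m ord0 i / r ord0 i) => //.
    - exact: ltW.
    - by rewrite divr_ge0// ltW.
    - by move=> /eqP; rewrite gt_eqF.
    - by move=> qi; rewrite divr_gt0// mix_gt0l// (ltW t0).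
    by move: le1; rewrite [r ord0 i * _]mulrC divfK ?gt_eqF.
  apply: le_trans (ler_sum _ (fun i _ => H i)) _.
  by rewrite big_split/= sumrB sm.2 sq.2 subrr addr0.
have mE : \sum_i m ord0 i * ln (m ord0 i / r ord0 i) =
    (1 - t) * (\sum_i q ord0 i * ln (m ord0 i / r ord0 i)) +
    t * (\sum_i q' ord0 i * ln (m ord0 i / r ord0 i)).
  rewrite !mulr_sumr -big_split; apply: eq_bigr => i _.
  by rewrite {1}mixE mulrDl !mulrA.
have vq' : v <= \sum_i q' ord0 i * ln (m ord0 i / r ord0 i).
  rewrite -(ler_pM2l t0) -(lerD2l ((1 - t) * v)).
  rewrite (_ : (1 - t) * v + t * v = v); last by ring.
  by rewrite (le_trans vm)// mE lerD2r ler_wpM2l// subr_ge0 ltW.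
apply: le_trans vq' _; rewrite mulr_sumr -big_split/=; apply: ler_sum => i _.
have := q'0 i; rewrite le_eqVlt => /predU1P[<-|qi].
  by rewrite !mul0r mulr0 addr0.
have mi : 0 < m ord0 i by rewrite mix_gt0r ?t0 ?(ltW t1).
have ri := r0 i; have yi := y0 i.
rewrite mulrCA -mulrDr ler_pM2l//.
have z0 : 0 < m ord0 i / r ord0 i / y ord0 i.
  by apply: divr_gt0 => //; exact: divr_gt0.
have -> : ln (m ord0 i / r ord0 i) =
    ln (y ord0 i) + ln (m ord0 i / r ord0 i / y ord0 i).
  by rewrite -lnM ?posrE// [y ord0 i * _]mulrC divfK// gt_eqF.
rewrite -!addrA lerD2l; apply: le_trans (ln_leif_sub1 z0).1 _.
rewrite le_eqVlt; apply/orP; left; apply/eqP.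
by rewrite /m mixE mxE; field; rewrite !gt_eqF.
Qed.

(** With [r = (1 - e) p + e p0] at a minimizer of the perturbed problem, the
witness is [(1 - e) q / r]: a constraint at [(1 - e) p' + e p0] dominates
[1 - e] times the constraint at [p']. *)
Lemma near_optimal_evar A B e p0 (v : R) : A `<=` simplex -> B `<=` simplex ->
  A !=set0 -> B !=set0 ->
  convex_set (A : set (convex_lmodType 'rV[R]_n.+1)) ->
  convex_set (B : set (convex_lmodType 'rV[R]_n.+1)) ->
  compact A -> compact B ->
  A p0 -> (forall i, 0 < p0 ord0 i) -> 0 < e < 1 ->
  (forall p q, A p -> B q -> (v%:E <= kl q p)%E) ->
  exists x, [/\ forall i, 0 <= x ord0 i,
    forall p, A p -> \sum_i p ord0 i * x ord0 i <= 1 &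
    forall q, B q -> ((v + ln (1 - e))%:E <= elog q x)%E].
Proof.
move=> sA sB A0 B0 cvA cvB cA cB Ap0 p0_gt0 e01 hv.
have /andP[e0 e1] := e01.
have e01' : 0 <= e <= 1 by rewrite !ltW.
have sp0 := sA _ Ap0.
have [p [q [Ap Bq pq_min]]] := kl_mix_min sA sB A0 B0 cA cB sp0 e01'.
set r := mix e p p0 in pq_min.
have Ar : A r by exact: convex_set_mix.
have r0 i : 0 < r ord0 i.
  by apply: mix_gt0r => //; [rewrite e0 ltW|exact: (simplex_ge0 _ (sA _ Ap))].
have sr := sA _ Ar; have sq := sB _ Bq.
have t01' t : 0 < t < 1 -> 0 <= t <= 1 by move=> /andP[t0 t1]; rewrite !ltW.
have feas p' : A p' -> \sum_i mix e p' p0 ord0 i * (q ord0 i / r ord0 i) <= 1.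
  move=> Ap'; apply: kl_min_dual_feasible => //.
    exact: (sA _ (convex_set_mix cvA e01' Ap' Ap0)).
  move=> t t01; rewrite (_ : mix t r _ = mix e (mix t p p') p0).
    by apply: pq_min => //; apply: convex_set_mix => //; exact: t01'.
  by apply/rowP => i; rewrite !(mixE, mxE); ring.
have opt q' : B q' -> (kl q r <= elog q' (\row_i (q ord0 i / r ord0 i))%R)%E.
  move=> Bq'; apply: kl_min_le_elog => //; first exact: sB.
  move=> t t01; apply: pq_min => //.
  by apply: convex_set_mix => //; exact: t01'.
have e1' : 0 < 1 - e by rewrite subr_gt0.
pose z : 'rV[R]_n.+1 := \row_i (q ord0 i / r ord0 i).
have zE i : z ord0 i = q ord0 i / r ord0 i by rewrite mxE.
have xE i : ((1 - e) *: z) ord0 i = (1 - e) * z ord0 i by rewrite mxE.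
have z0 i : 0 <= z ord0 i.
  by rewrite zE divr_ge0 ?(ltW (r0 i))// (simplex_ge0 _ sq).
exists ((1 - e) *: z); split.
- by move=> i; rewrite xE mulr_ge0// ltW.
- move=> p' Ap'; apply: le_trans (feas p' Ap'); apply: ler_sum => i _.
  rewrite -subr_ge0 mixE xE -zE.
  rewrite (_ : _ - _ = e * p0 ord0 i * z ord0 i); last by ring.
  by rewrite mulr_ge0// mulr_ge0 ?ltW.
- move=> q' Bq'; have sq' := sB _ Bq'.
  have q'0 i := simplex_ge0 i sq'.
  have := le_trans (hv _ _ Ar Bq) (opt q' Bq'); rewrite -/z.
  have [->|qz] := elogP z q'0; first by rewrite leeNy_eq.
  rewrite !elog_fin//; last by move=> i qi; rewrite xE mulr_gt0// qz.
  rewrite !lee_fin => vle.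
  have -> : v + ln (1 - e) = v + \sum_i q' ord0 i * ln (1 - e).
    by rewrite -mulr_suml sq'.2 mul1r.
  apply: le_trans (lerD vle (lexx _)) _.
  rewrite -big_split/=; apply: ler_sum => i _.
  have := q'0 i; rewrite le_eqVlt => /predU1P[<-|qi].
    by rewrite !mul0r addr0.
  by rewrite xE lnM ?posrE ?qz// mulrDr addrC.
Qed.

(** Averaging a point of [A] that charges the first [k] points of the space with
one that charges the next extends the support; hence the induction on [k]. *)
Lemma positive_point A : A `<=` simplex -> A !=set0 ->
  convex_set (A : set (convex_lmodType 'rV[R]_n.+1)) ->
  (forall i : 'I_n.+1, 0 < sup [set p ord0 i | p in A]) ->
  exists2 p, A p & forall i, 0 < p ord0 i.
Proof.
move=> sA [pA ApA] cvA supA.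
suff H k : exists2 p, A p & forall i : 'I_n.+1, (i < k)%N -> 0 < p ord0 i.
  by have [p Ap h] := H n.+1; exists p => // i; exact: h.
elim: k => [|k [p Ap h]]; first by exists pA.
have [nk|kn] := leqP n.+1 k.
  by exists p => // i _; apply: h; exact: leq_trans nk.
have [|_ [q Aq <-] qk] := sup_gt _ (supA (Ordinal kn)).
  by exists (pA ord0 (Ordinal kn)), pA.
have half : 0 < (2^-1 : R) < 1 by rewrite invr_gt0 ltr0n/= invf_lt1 ?ltr1n.
have /andP[half0 half1] := half.
exists (mix 2^-1 p q) => [|i].
  by apply: convex_set_mix => //; rewrite !ltW.
have p0 := simplex_ge0 i (sA _ Ap); have q0 := simplex_ge0 i (sA _ Aq).
rewrite ltnS leq_eqVlt => /orP[/eqP ik|ik].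
  apply: mix_gt0r => //; first by rewrite half0 ltW.
  by rewrite (_ : i = Ordinal kn)//; exact: val_inj.
by apply: mix_gt0l => //; [rewrite half1 ltW|exact: h].
Qed.

(** Strong duality.  The maximizer [x] comes from [elog_max], so no limit of the
near-optimal e-variables has to be taken. *)
Lemma kl_elog_saddle A B : A `<=` simplex -> B `<=` simplex ->
  A !=set0 -> B !=set0 ->
  convex_set (A : set (convex_lmodType 'rV[R]_n.+1)) ->
  convex_set (B : set (convex_lmodType 'rV[R]_n.+1)) ->
  compact A -> compact B ->
  (forall i : 'I_n.+1, 0 < sup [set p ord0 i | p in A]) ->
  exists p q x, [/\ A p, B q, kl q p \is a fin_num,
    forall p' q', A p' -> B q' -> (kl q p <= kl q' p')%E &
    [/\ forall i, 0 <= x ord0 i,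
      forall p', A p' -> \sum_i p' ord0 i * x ord0 i <= 1 &
      forall q', B q' -> (kl q p <= elog q' x)%E]].
Proof.
move=> sA sB A0 B0 cvA cvB cA cB supA.
have [p0 Ap0 p0_gt0] := positive_point sA A0 cvA supA.
have [p [q [Ap Bq pq_min]]] := kl_min sA sB A0 B0 cA cB.
have [x [x0 xA xmax]] := elog_max sB Ap0 p0_gt0.
have fin : kl q p \is a fin_num.
  have : (kl q p < +oo)%E.
    apply: le_lt_trans (pq_min _ _ Ap0 Bq) _.
    by rewrite kl_fin ?ltry// => i /eqP; rewrite gt_eqF.
  by rewrite /kl; case: asboolP.
exists p, q, x; split => //; split => // q' Bq'.
apply: (@le_trans _ _ (ereal_inf [set elog q x | q in B])); last first.
  by apply: ereal_inf_lbound; exists q'.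
rewrite -(fineK fin); set v := fine _.
apply/lee_addgt0Pr => d d0.
(* so that ln (1 - e) = - d *)
pose e : R := 1 - expR (- d).
have e01 : 0 < e < 1.
  by rewrite subr_gt0 gtrBl expR_gt0 andbT -expR0 ltr_expR oppr_lt0.
have v_min p' q'' : A p' -> B q'' -> (v%:E <= kl q'' p')%E.
  by move=> Ap' Bq''; rewrite fineK//; exact: pq_min.
have [y [y0 yA yB]] :=
  near_optimal_evar sA sB A0 B0 cvA cvB cA cB Ap0 p0_gt0 e01 v_min.
rewrite -leeBlDr//; apply: le_trans (xmax y y0 yA).
apply: le_ereal_inf_tmp => _ [q'' Bq'' <-]; apply: le_trans (yB _ Bq'').
by rewrite /e subKr expRK EFinD EFinN.
Qed.

End Duality.

(** * Probabilities on the finite space as vectors *)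

Section FiniteSpace.
Context {R : realType} {n : nat}.
Implicit Types (P Q : probability (Omega n) R) (f g X : Omega n -> \bar R).
Local Open Scope ereal_scope.

Lemma measurable_Omega (S : set (Omega n)) : measurable S.
Proof. by []. Qed.

Lemma vecE P (i : Omega n) : (vec P ord0 i)%:E = P [set i].
Proof. by rewrite mxE fineK// fin_num_measure. Qed.

Lemma vec_ge0 P i : (0 <= vec P ord0 i)%R.
Proof. by rewrite mxE fine_ge0. Qed.

Lemma setT_Omega : [set: Omega n] =
  \big[setU/set0]_(i <- index_enum 'I_n.+1) [set (i : Omega n)].
Proof.
rewrite -bigcup_seq; apply/seteqP; split => // i _.
by exists i => //=; rewrite mem_index_enum.
Qed.

Lemma ge0_integral_Omega P f : (forall i, 0 <= f i) ->
  \int[P]_w f w = \sum_i (vec P ord0 i)%:E * f i.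
Proof.
move=> f0.
rewrite setT_Omega ge0_integral_bigsetU//; last 2 first.
- exact: index_enum_uniq.
- by move=> i j _ _ [x [/= -> ->]].
apply: eq_bigr => i _.
rewrite (@eq_integral _ _ _ _ _ (cst (f i))); last first.
  by move=> w; rewrite inE /= => ->.
rewrite integral_cst// muleC; congr (_ * _); exact/esym/vecE.
Qed.

Lemma simplex_vec P : simplex (vec P).
Proof.
apply: simplex_intro => [i|]; first exact: vec_ge0.
apply: EFin_inj; rewrite -sumEFin.
rewrite -[RHS](@probability_setT _ _ _ P) -[RHS]mul1e -integral_cst//.
by rewrite ge0_integral_Omega//; apply: eq_bigr => i _; rewrite mule1.
Qed.

Lemma sumeB (I : finType) (f g : I -> \bar R) : (forall i, 0 <= g i) ->
  \sum_i (f i - g i) = \sum_i f i - \sum_i g i.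
Proof.
move=> g0; rewrite big_split/= sumeN// => i j _ _.
by apply: ge0_adde_def; rewrite inE.
Qed.

(** As [+oo - oo = -oo] in the extended reals, an indeterminate integral and the
corresponding sum have the same value. *)
Lemma integral_Omega P f :
  \int[P]_w f w = \sum_i (vec P ord0 i)%:E * f i.
Proof.
rewrite integralE !ge0_integral_Omega// -sumeB; last first.
  by move=> i; rewrite mule_ge0// lee_fin vec_ge0.
apply: eq_bigr => i _.
by rewrite [in RHS](funeposneg f) muleBr// add_def_funeposneg.
Qed.

Lemma measure_Omega P (S : set (Omega n)) :
  P S = (\sum_i vec P ord0 i * \1_S i)%:E.
Proof.
by rewrite -sumEFin -[S in LHS]setIT -integral_indic// integral_Omega.
Qed.

(** The witness is a combination of point masses.  It has total mass [1], so
normalizing it only turns the measure into a probability. *)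
Lemma vec_surjective p : simplex p -> exists P, vec P = p.
Proof.
move=> sp; have p0 i : (0 <= p ord0 i)%R by exact: simplex_ge0.
pose m : {measure set (Omega n) -> \bar R} :=
  msum (fun k => mscale (NngNum (p0 (inord k)))
    (\d_(inord k : Omega n) : {measure set (Omega n) -> \bar R})) n.+1.
have mE S : m S = \sum_i (p ord0 i)%:E * (\1_S i)%:E.
  rewrite /m /= /msum; apply: eq_bigr => i _.
  rewrite -[i in RHS]inord_val.
  change (mscale (NngNum (p0 (inord i))) (\d_(inord i : Omega n)) S =
    (p ord0 (inord i))%:E * (\1_S (inord i : Omega n))%:E).
  by rewrite /mscale.
have m1 : m setT = 1.
  rewrite mE -sp.2 -sumEFin; apply: eq_bigr => i _.
  by rewrite indicT mule1.
exists (mnormalize m (\d_(ord0 : Omega n))).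
have E S : mnormalize m (\d_(ord0 : Omega n)) S = m S.
  by rewrite /mnormalize m1 onee_eq0/= invr1 mule1.
apply/rowP => i; rewrite mxE [X in fine X]E mE (bigD1 i)//= big1 ?adde0.
  by rewrite indicE mem_set// mule1.
by move=> j ji; rewrite indicE memNset ?mule0// => /= /eqP; rewrite (negbTE ji).
Qed.

Lemma dominatesE Q P :
  Q `<< P <-> forall i, (vec P ord0 i = 0 -> vec Q ord0 i = 0)%R.
Proof.
split=> [/null_content_dominatesP QP i pi|h].
  apply: EFin_inj; rewrite vecE; apply: QP; first exact: measurable_Omega.
  by rewrite -[LHS]vecE pi.
apply/null_content_dominatesP => S _ PS0.
have /eqP : (\sum_i vec P ord0 i * \1_S i = 0)%R
  by apply: EFin_inj; rewrite -measure_Omega.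
rewrite measure_Omega psumr_eq0; last first.
  by move=> i _; apply: mulr_ge0 => //; exact: vec_ge0.
move=> /allP PS; rewrite big1// => i _.
have := PS i (mem_index_enum i); rewrite /= mulf_eq0.
by move=> /orP[/eqP /h ->|/eqP ->]; rewrite ?mul0r ?mulr0.
Qed.

(** A Radon-Nikodym derivative is determined at every point that [P] charges, by
integrating it over that point. *)
Lemma RNE Q P i : Q `<< P -> (0 < vec P ord0 i)%R ->
  RN Q P i = (vec Q ord0 i / vec P ord0 i)%:E.
Proof.
move=> QP pi.
have : (vec Q ord0 i)%:E = RN Q P i * (vec P ord0 i)%:E.
  have := @Radon_Nikodym_integral _ _ _ (charge_of_finite_measure Q) P
    [set (i : Omega n)] QP (measurable_Omega _).
  rewrite (@eq_integral _ _ _ _ _ (cst (RN Q P i))); last first.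
    by move=> w; rewrite inE /= => ->.
  by rewrite integral_cst// !vecE.
have := @Radon_Nikodym_fin_num _ _ _ (charge_of_finite_measure Q) P i QP.
rewrite -/(RN Q P i) => /fineK <-; rewrite -EFinM => -[->].
by rewrite mulfK// gt_eqF.
Qed.

Lemma H_vec Q P : H Q P = kl (vec Q) (vec P).
Proof.
rewrite /H /kl; case: asboolP => QP; case: asboolP => //.
- move=> dom; rewrite integral_Omega -sumEFin; apply: eq_bigr => i _.
  have := vec_ge0 Q i; rewrite le_eqVlt => /predU1P[<-|qi].
    by rewrite mul0e mul0r.
  have pi : (0 < vec P ord0 i)%R.
    rewrite lt_neqAle vec_ge0 andbT eq_sym; apply/eqP => /dom q0.
    by rewrite q0 ltxx in qi.
  by rewrite RNE// lne_EFin ?divr_gt0// EFinM.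
- by move: QP => /dominatesE.
- by move=> /dominatesE.
Qed.

Lemma Elog_vec Q X : (forall i, X i \is a fin_num) ->
  Elog Q X = elog (vec Q) (\row_i fine (X i)).
Proof.
move=> Xfin; rewrite /Elog.
have -> : elog (vec Q) (\row_i fine (X i)) = \int[Q]_w lne (X w).
  rewrite integral_Omega; apply: eq_bigr => i _.
  by congr (_ * lne _); rewrite mxE fineK.
case: ifPn => [_|]; first exact/esym/integralE.
rewrite -leNgt leye_eq => /eqP neg.
by rewrite [RHS]integralE neg addeNy.
Qed.

End FiniteSpace.

(** * E-variables on the finite space *)

Section EVariables.
Context {R : realType} {n : nat}.
Implicit Types (A : set 'rV[R]_n.+1) (X : Omega n -> \bar R).

(** The constraint at [p] bounds [p_i X_i] by [1]. *)
Lemma evar_fin_num A p X : simplex p -> A p -> (forall i, 0 < p ord0 i) ->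
  evar (measures A) X -> forall i, X i \is a fin_num.
Proof.
move=> sp Ap p0 [X0 XA] i.
have [P vP] := vec_surjective sp.
have : (\int[P]_w X w <= 1)%E by apply: XA; rewrite /measures/= vP.
rewrite integral_Omega vP (bigD1 i)//= => le1.
have pX_ge0 j : (0 <= (p ord0 j)%:E * X j)%E by rewrite mule_ge0// lee_fin ltW.
have : ((p ord0 i)%:E * X i < +oo)%E.
  apply: le_lt_trans (ltry 1); apply: le_trans le1; rewrite leeDl//.
  exact: sume_ge0.
rewrite ge0_fin_numE//; apply: contraTT.
by rewrite -!leNgt !leye_eq => /eqP ->; rewrite gt0_muley// lte_fin.
Qed.

Lemma evar_sum_le1 A P X : (forall i, X i \is a fin_num) ->
  measures A P -> evar (measures A) X ->
  \sum_i vec P ord0 i * (\row_j fine (X j)) ord0 i <= 1.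
Proof.
move=> Xfin AP [_ /(_ _ AP)]; rewrite integral_Omega -lee_fin -sumEFin.
apply: le_trans; rewrite le_eqVlt; apply/orP; left; apply/eqP.
by apply: eq_bigr => i _; rewrite EFinM mxE fineK.
Qed.

Lemma evar_bounded A p : simplex p -> A p -> (forall i, 0 < p ord0 i) ->
  evar (measures A) = evar_b (measures A).
Proof.
move=> sp Ap p0; apply/seteqP; split => [X eX|X []//]; split => //.
have Xfin := evar_fin_num sp Ap p0 eX.
apply: (@le_lt_trans _ _ (\sum_i (fine (X i))%:E)%E); last first.
  by rewrite sumEFin ltry.
apply: ge_ereal_sup => _ [i _ <-].
rewrite (bigD1 i)//= fineK// leeDl//.
by apply: sume_ge0 => j _; rewrite lee_fin fine_ge0// eX.1.
Qed.

End EVariables.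

Theorem theorem4p23 (R : realType) (n : nat) (A B : set 'rV[R]_n.+1)
    (A_simplex : A `<=` simplex) (B_simplex : B `<=` simplex)
    (A_nonempty : A !=set0) (B_nonempty : B !=set0)
    (A_convex : convex_set (A : set (convex_lmodType 'rV[R]_n.+1)))
    (B_convex : convex_set (B : set (convex_lmodType 'rV[R]_n.+1)))
    (A_compact : compact A) (B_compact : compact B)
    (A_supp : forall i : 'I_n.+1, 0 < sup [set p ord0 i | p in A]) :
  let PP := measures A in
  let QQ := measures B in
  [/\ evar PP = evar_b PP,
      G PP QQ = G_b PP QQ
        /\ is_max [set growth QQ X | X in evar_b PP] (G PP QQ),
      exists h : probability (Omega n) R -> \bar R,
        (forall Q, QQ Q -> is_min [set H Q P | P in PP] (h Q))
        /\ is_min [set h Q | Q in QQ] (G PP QQ),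
      G PP QQ \is a fin_num &
      forall (X : Omega n -> \bar R) (P Q : probability (Omega n) R),
        evar_b PP X -> growth QQ X = G PP QQ ->
        PP P -> QQ Q ->
        (forall P' Q', PP P' -> QQ Q' -> (H Q P <= H Q' P')%E) ->
        {ae P, forall w, X w = RN Q P w}].
Proof.
move=> PP QQ.
have [p0 Ap0 p0_gt0] := positive_point A_simplex A_nonempty A_convex A_supp.
have sp0 := A_simplex _ Ap0.
have [p [q [x [Ap Bq fin pq_min [x0 xA xB]]]]] :=
  kl_elog_saddle A_simplex B_simplex A_nonempty B_nonempty A_convex B_convex
    A_compact B_compact A_supp.
have [P0 vP0] := vec_surjective (A_simplex _ Ap).
have [Q0 vQ0] := vec_surjective (B_simplex _ Bq).
have PP0 : PP P0 by rewrite /PP/measures/= vP0.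
have QQ0 : QQ Q0 by rewrite /QQ/measures/= vQ0.
set v := kl q p in fin pq_min xB.
have vE : H Q0 P0 = v by rewrite H_vec vP0 vQ0.
have v_min P Q : PP P -> QQ Q -> (v <= H Q P)%E.
  by move=> PPP QQQ; rewrite H_vec; exact: pq_min.
have evb : evar PP = evar_b PP by exact: evar_bounded Ap0 p0_gt0.
have Xfin X : evar PP X -> forall i, X i \is a fin_num.
  exact: evar_fin_num Ap0 p0_gt0.
have Elog_le X P Q : evar PP X -> PP P -> (Elog Q X <= H Q P)%E.
  move=> eX PPP; rewrite Elog_vec ?H_vec; last exact: Xfin.
  apply: elog_le_kl.
  - exact: simplex_vec.
  - by move=> i; exact: vec_ge0.
  - by move=> i; rewrite mxE fine_ge0// eX.1.
  - exact: evar_sum_le1 (Xfin _ eX) PPP eX.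
have growth_le X : evar PP X -> (growth QQ X <= v)%E.
  move=> eX; apply: (@le_trans _ _ (Elog Q0 X)); last by rewrite -vE Elog_le.
  by apply: ereal_inf_lbound; exists Q0.
pose Y (i : Omega n) := (x ord0 i)%:E.
have Yx : \row_i fine (Y i) = x by apply/rowP => i; rewrite mxE.
have eY : evar PP Y.
  split => [i|P PPP]; first by rewrite lee_fin.
  rewrite integral_Omega (eq_bigr (fun i => (vec P ord0 i * x ord0 i)%:E))//.
  by rewrite sumEFin lee_fin; exact: xA.
have gY : growth QQ Y = v.
  apply/le_anti; rewrite growth_le//=; apply: le_ereal_inf_tmp => _ [Q QQQ <-].
  by rewrite Elog_vec// Yx; exact: xB.
have GE : G PP QQ = v.
  apply/le_anti/andP; split.
    by apply: ge_ereal_sup => _ [X eX <-]; exact: growth_le.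
  by rewrite -gY; apply: ereal_sup_ubound; exists Y.
split => //.
- split; first by rewrite /G /G_b evb.
  rewrite GE; split; first by exists Y => //; rewrite -evb.
  by move=> _ [X + <-]; rewrite -evb; exact: growth_le.
- pose h Q := ereal_inf [set H Q P | P in PP].
  have h_attained Q : QQ Q -> exists2 P, PP P & h Q = H Q P.
    (* the existence result for pairs, with a single candidate for q *)
    move=> QQQ.
    have sQ : [set vec Q] `<=` simplex by move=> _ ->; exact: simplex_vec.
    have Q_nonempty : [set vec Q] !=set0 by exists (vec Q).
    have [p' [_ [Ap' -> p'_min]]] :=
      kl_min A_simplex sQ A_nonempty Q_nonempty A_compact
        (@compact_set1 _ (vec Q)).
    have [P vP] := vec_surjective (A_simplex _ Ap').
    exists P; first by rewrite /PP/measures/= vP.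
    apply/le_anti/andP; split.
      by apply: ereal_inf_lbound; exists P => //; rewrite /PP/measures/= vP.
    apply: le_ereal_inf_tmp => _ [P' PPP' <-].
    by rewrite !H_vec vP; exact: p'_min.
  exists h; split => [Q QQQ|].
    have [P PPP hQ] := h_attained Q QQQ.
    split; first by exists P.
    by move=> _ [P' PPP' <-]; apply: ereal_inf_lbound; exists P'.
  rewrite GE; split.
    exists Q0 => //; apply/le_anti/andP; split.
      by apply: ereal_inf_lbound; exists P0.
    by apply: le_ereal_inf_tmp => _ [P PPP <-]; exact: v_min.
  by move=> _ [Q QQQ <-]; have [P PPP ->] := h_attained Q QQQ; exact: v_min.
- by rewrite GE.
- move=> X P Q [eX _] gX PPP QQQ PQ_min.
  have HPQ : H Q P = v.
    by apply/le_anti; rewrite v_min// -vE PQ_min.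
  have QP : Q `<< P.
    by move: HPQ fin; rewrite /H; case: asboolP => // _ <-.
  (* the growth of X is squeezed: weak duality is an equality at (P, Q) *)
  have ElogX : Elog Q X = H Q P.
    apply/le_anti; rewrite Elog_le//= HPQ -GE -gX.
    by apply: ereal_inf_lbound; exists Q.
  have XE i : vec Q ord0 i = (vec P ord0 i * (\row_j fine (X j)) ord0 i)%R.
    apply: elog_eq_kl.
    - exact: simplex_vec.
    - by move=> j; exact: vec_ge0.
    - by move=> j; rewrite mxE fine_ge0// eX.1.
    - exact: evar_sum_le1 (Xfin _ eX) PPP eX.
    - by rewrite -H_vec HPQ.
    - by rewrite -H_vec -ElogX Elog_vec//; exact: Xfin.
  exists [set i | vec P ord0 i = 0%R]; split; first exact: measurable_Omega.
    rewrite measure_Omega big1// => i _.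
    have [pi|pi] := eqVneq (vec P ord0 i) 0%R; first by rewrite pi mul0r.
    by rewrite indicE memNset ?mulr0// => /eqP; rewrite (negbTE pi).
  move=> i /=; apply: contra_notP => /eqP pi.
  have {}pi : 0 < vec P ord0 i by rewrite lt_neqAle eq_sym pi vec_ge0.
  rewrite RNE// XE mxE mulrAC divff ?gt_eqF// mul1r fineK//.
  exact: Xfin.
Qed.
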